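(* Consider $G:\mathbb{R}^d\times\mathscr{P}_2(\mathbb{R}^d)\to\mathbb{R}$ of the form $G(x,m)=x\cdot\sigma_T(m)$, where $\sigma_T:\mathscr{P}_2(\mathbb{R}^d)\to\mathbb{R}^d$. Then, in general, condition $(\sigma)$ does not imply any of the conditions (LL), (D) or $(\mathrm{L}^2)$; that is, there exist a dimension $d$ and a map $\sigma_T$ for which $(\sigma)$ holds but none of (LL), (D), $(\mathrm{L}^2)$ holds.
   Context: $\mathscr{P}_2(\mathbb{R}^d)$: Borel probability measures on $\mathbb{R}^d$ with finite second moment. $(\Omega,\mathcal{A},\mathbb{P})$ is an atomless probability space, $\mathbb{H}=L^2(\Omega;\mathbb{R}^d)$, $\mathcal{L}_X$ the law of $X\in\mathbb{H}$. (LL): $\int_{\mathbb{R}^d}(G(x,m_1)-G(x,m_2))\,d(m_1-m_2)(x)\ge0$ for all $m_1,m_2\in\mathscr{P}_2(\mathbb{R}^d)$. (D): $\mathbb{E}[(D_xG(X_1,\mathcal{L}_{X_1})-D_xG(X_2,\mathcal{L}_{X_2}))\cdot(X_1-X_2)]\ge0$ for all $X_1,X_2\in\mathbb{H}$. The Lagrangian is $L(x,v)=\frac12|v|^2$ and $G(x,m)=g(x,\sigma_T(m))$ with $g(x,\sigma)=x\cdot\sigma$. For an initial random variable $X_0\in\mathbb{H}$ of law $m_0$ and $T>0$ put $$\tilde E_T(X)=(I+T\,D_xG(\cdot,\mathcal{L}_X))^{-1}(X_0)=X_0-T\sigma_T(\mathcal{L}_X),\qquad\Omega(\sigma)=\sigma_T\big((x\mapsto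 x-T\sigma)_\sharp m_0\big).$$ Condition $(\mathrm{L}^2)$: for all $X_0\in\mathbb{H}$ and all $T>0$, $\mathbb{E}[(\tilde E_T(X_1)-\tilde E_T(X_2))\cdot(X_1-X_2)]\le\mathbb{E}|X_1-X_2|^2$ for all $X_1,X_2\in\mathbb{H}$. Condition $(\sigma)$: for all $m_0\in\mathscr{P}_2(\mathbb{R}^d)$ and all $T>0$, $(\Omega(\sigma_1)-\Omega(\sigma_2))\cdot(\sigma_1-\sigma_2)\le|\sigma_1-\sigma_2|^2$ for all $\sigma_1,\sigma_2\in\mathrm{range}\,\sigma_T$. In $\sigma_T$ the subscript $T$ is only notation: the map $\sigma_T$ does not vary with the horizon. *)

(* Defs.v *)
From HB Require Import structures.
From mathcomp Require Import all_boot all_order all_algebra.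
From mathcomp Require Import all_classical all_reals all_analysis.
From mathcomp Require Import measurable_realfun.
From mathcomp Require Import ring lra.

Set Implicit Arguments.
Unset Strict Implicit.
Unset Printing Implicit Defensive.

Import Order.TTheory GRing.Theory Num.Theory.
Import numFieldNormedType.Exports.

Local Open Scope classical_set_scope.
Local Open Scope ring_scope.

(* The norm that the library puts on ['rV[R]_d] is the sup norm, so the
   Euclidean structure is introduced separately. *)
Definition dot {R : realType} {d : nat} (x y : 'rV[R]_d) : R :=
  \sum_(i < d) x 0 i * y 0 i.

Definition sqnorm {R : realType} {d : nat} (x : 'rV[R]_d) : R := dot x x.

(* R^d with its Borel sigma-algebra; the carrier is ['rV[R]_d] itself. *)
Definition borelRd (R : realType) (d : nat) :=
  g_sigma_algebraType (@open 'rV[R]_d).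

Section borel.
Context {R : realType} {d : nat}.

Lemma sqnorm_ge0 (x : 'rV[R]_d) : 0 <= sqnorm x.
Proof. by apply: sumr_ge0 => i _; rewrite -expr2 sqr_ge0. Qed.

Lemma sqnormB_le (x y : 'rV[R]_d) :
  sqnorm (x - y) <= 2 * sqnorm x + 2 * sqnorm y.
Proof.
rewrite /sqnorm /dot !mulr_sumr -big_split /=; apply: ler_sum => i _.
rewrite !mxE; have := sqr_ge0 (x 0 i + y 0 i); lra.
Qed.

Lemma measurable_fun_coord (i : 'I_d) :
  measurable_fun [set: borelRd R d] (fun x : borelRd R d => (x : 'rV[R]_d) 0 i).
Proof.
apply: (measurability _ (RGenOInfty.measurableE R)) => //.
move=> _ [_ [a ->] <-]; apply: sub_sigma_algebra; rewrite setTI.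
have /continuousP := @coord_continuous R 1 d 0 i.
by apply; exact: interval_open.
Qed.

Lemma measurable_sqnorm :
  measurable_fun [set: borelRd R d] (fun x : borelRd R d => sqnorm (x : 'rV[R]_d)).
Proof.
apply: measurable_sum => i.
by apply: measurable_funM; exact: measurable_fun_coord.
Qed.

Lemma measurable_translation (c : 'rV[R]_d) :
  measurable_fun [set: borelRd R d] (fun x : borelRd R d => (x - c) : borelRd R d).
Proof.
apply: (@measurability _ _ (borelRd R d) (borelRd R d) _ _ (@open 'rV[R]_d)) => //.
move=> _ [B oB <-]; apply: sub_sigma_algebra; rewrite setTI.
have /continuousP : continuous (fun x : 'rV[R]_d => x - c).
  by move=> x; apply: continuousB; [exact: (fun A => id)|exact: cst_continuous].
exact.
Qed.

End borel.

Record P2 (R : realType) (d : nat) := MkP2 {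
  P2_prob :> probability (borelRd R d) R ;
  P2_moment : (\int[P2_prob]_x (sqnorm (x : 'rV[R]_d))%:E < +oo)%E }.

(* L^2(Om; R^d), an element being given by one of its representatives. *)
Record L2rv (dsp : measure_display) (Om : measurableType dsp) (R : realType)
    (P : probability Om R) (d : nat) := MkL2rv {
  L2rv_fun : {RV P >-> borelRd R d} ;
  L2rv_moment : (\int[P]_w (sqnorm (L2rv_fun w : 'rV[R]_d))%:E < +oo)%E }.

Definition L2val {dsp : measure_display} {Om : measurableType dsp}
    {R : realType} {P : probability Om R} {d : nat} (X : L2rv P d) (w : Om) :
  'rV[R]_d := L2rv_fun X w.
Coercion L2val : L2rv >-> Funclass.

Section law.
Context {dsp : measure_display} {Om : measurableType dsp} {R : realType}.
Context {P : probability Om R} {d : nat}.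

Lemma law_moment (X : L2rv P d) :
  (\int[distribution P (L2rv_fun X)]_x (sqnorm (x : 'rV[R]_d))%:E < +oo)%E.
Proof.
rewrite ge0_integral_distribution; first exact: L2rv_moment.
- by apply/measurable_EFinP; exact: measurable_sqnorm.
- by move=> y; rewrite lee_fin sqnorm_ge0.
Qed.

Definition law (X : L2rv P d) : P2 R d := @MkP2 R d (distribution P (L2rv_fun X)) (law_moment X).

End law.

Section translation.
Context {R : realType} {d : nat} (m : P2 R d) (c : 'rV[R]_d).

Definition translation (x : borelRd R d) : borelRd R d := x - c.

HB.instance Definition _ :=
  isMeasurableFun.Build _ _ _ _ translation (measurable_translation c).

Lemma translation_moment :
  (\int[m]_x (sqnorm (translation x : 'rV[R]_d))%:E < +oo)%E.
Proof.
have msq : measurable_fun [set: borelRd R d]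
    (fun x => (sqnorm (x : 'rV[R]_d))%:E).
  by apply/measurable_EFinP; exact: measurable_sqnorm.
apply: (@le_lt_trans _ _
  (\int[m]_x (2%:E * (sqnorm (x : 'rV[R]_d))%:E + (2 * sqnorm c)%:E))%E).
  apply: ge0_le_integral => //.
  - by move=> x _; rewrite lee_fin sqnorm_ge0.
  - exact: (measurableT_comp msq (measurable_translation c)).
  - by apply: emeasurable_funD => //; exact: measurable_funeM.
  - by move=> x _; rewrite lee_fin sqnormB_le.
rewrite ge0_integralD//; last 3 first.
- by move=> x _; rewrite mule_ge0// lee_fin sqnorm_ge0.
- exact: measurable_funeM.
- by move=> x _; rewrite lee_fin mulr_ge0// sqnorm_ge0.
rewrite ge0_integralZl//; last by move=> x _; rewrite lee_fin sqnorm_ge0.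
rewrite integral_cst//= probability_setT mule1.
apply: lte_add_pinfty; last exact: ltry.
by apply: lte_mul_pinfty => //; exact: P2_moment.
Qed.

(* The translation x |-> x - c, as a square-integrable random vector on the
   probability space (R^d, m). *)
Definition translation_L2 : L2rv m d :=
  @MkL2rv _ _ R m d translation translation_moment.

End translation.

Section conditions.
Context {R : realType} {d : nat}.
Implicit Types (G : 'rV[R]_d -> P2 R d -> R) (sigma : P2 R d -> 'rV[R]_d).

Definition grad_x G (x : 'rV[R]_d) (m : P2 R d) : 'rV[R]_d :=
  \row_(i < d) 'D_(delta_mx 0 i) (fun y : 'rV[R]_d => G y m : R^o) x.

Definition G_of sigma (x : 'rV[R]_d) (m : P2 R d) : R := dot x (sigma m).

Definition condLL G := forall m1 m2 : P2 R d,
  (0 <= \int[m1]_x (G x m1 - G x m2)%:E - \int[m2]_x (G x m1 - G x m2)%:E)%E.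

Definition Omega sigma (m0 : P2 R d) (T : R) (s : 'rV[R]_d) : 'rV[R]_d :=
  sigma (law (translation_L2 m0 (T *: s))).

Definition cond_sigma sigma := forall (m0 : P2 R d) (T : R), 0 < T ->
  forall s1 s2 : 'rV[R]_d, range sigma s1 -> range sigma s2 ->
  dot (Omega sigma m0 T s1 - Omega sigma m0 T s2) (s1 - s2)
    <= sqnorm (s1 - s2).

Context {dsp : measure_display} {Om : measurableType dsp}.
Variable P : probability Om R.

Definition condD G := forall X1 X2 : L2rv P d,
  (0 <= 'E_P[fun w =>
     dot (grad_x G (X1 w) (law X1) - grad_x G (X2 w) (law X2))
         (X1 w - X2 w)])%E.

(* (I + T D_xG(., m))^-1 ; [pinv_] is the inverse function when
   I + T D_xG(., m) is a bijection of R^d, as is the case for [G_of sigma]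
   (see [resolventE]). *)
Definition resolvent G (T : R) (m : P2 R d) : 'rV[R]_d -> 'rV[R]_d :=
  'pinv_(fun=> 0) setT (fun y => y + T *: grad_x G y m).

Definition Etilde G (T : R) (X0 X : L2rv P d) (w : Om) : 'rV[R]_d :=
  resolvent G T (law X) (X0 w).

Definition condL2 G := forall (X0 : L2rv P d) (T : R), 0 < T ->
  forall X1 X2 : L2rv P d,
  ('E_P[fun w => dot (Etilde G T X0 X1 w - Etilde G T X0 X2 w)
                     (X1 w - X2 w)]
    <= 'E_P[fun w => sqnorm (X1 w - X2 w)])%E.

Lemma grad_xE sigma x m : grad_x (G_of sigma) x m = sigma m.
Proof.
apply/rowP => i; rewrite mxE.
apply: cvg_lim => //=.
apply: (@cvg_trans _ ((fun=> sigma m 0 i : R^o) @ (0 : R)^')); last exact: cvg_cst.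
apply: near_eq_cvg; near=> h.
have h0 : h != 0 by near: h; exact: nbhs_dnbhs_neq.
have dotDl (u v w : 'rV[R]_d) : dot (u + v) w = dot u w + dot v w.
  by rewrite /dot -big_split/=; apply: eq_bigr => j _; rewrite mxE mulrDl.
rewrite /G_of dotDl addrK {1}/dot (bigD1 i)//= big1 => [|j ji]; last first.
  by rewrite !mxE (negbTE ji) andbF mulr0 mul0r.
by rewrite !mxE !eqxx mulr1 addr0 /GRing.scale/= mulKf.
Unshelve. all: by end_near. Qed.

Lemma resolventE sigma (T : R) m x :
  resolvent (G_of sigma) T m x = x - T *: sigma m.
Proof.
rewrite /resolvent.
have -> : (fun y => y + T *: grad_x (G_of sigma) y m) =
          (fun y => y + T *: sigma m).
  by apply/funext => y; rewrite grad_xE.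
rewrite -[in LHS](subrK (T *: sigma m) x).
by rewrite (@pinvKV _ _ _ _ (fun y => y + T *: sigma m)) ?inE// => y z _ _ /addIr.
Qed.

End conditions.

Definition atomless {dsp : measure_display} {Om : measurableType dsp}
    {R : realType} (P : probability Om R) :=
  forall A : set Om, measurable A -> (0 < P A)%E ->
  exists B : set Om,
    [/\ measurable B, B `<=` A, (0 < P B)%E & (P B < P A)%E].

(* Main.v *)
From HB Require Import structures.
Require Import Defs.
From mathcomp Require Import all_boot all_order all_algebra.
From mathcomp Require Import all_classical all_reals all_analysis.
From mathcomp Require Import measurable_realfun.
From mathcomp Require Import lra.

(** Each of (LL), (D) and (L^2) compares laws of arbitrary random vectors,
    whereas [Omega sigma m0 T] only ever sees translates of [m0].  So take a
    [sigma] that is invariant under translation but not constant: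
    [dirac_indicator u m] is [u] when [m] is a Dirac mass and [0] otherwise.
    Then [Omega] does not depend on its argument, and condition (sigma) reads
    [0 <= |s1 - s2|^2].

    The other conditions all see the quantity
    [E ((sigma (law X) - sigma (law Y)) . (X - Y))].  For [Y = 0] and
    [X = 1_B u] with [0 < P B < 1], the law of [Y] is a Dirac mass and that of
    [X] is not, so this quantity is [- |u|^2 P B < 0].  It is the expectation
    in (D), and also the integral in (LL) because [G] is linear in [x]; in
    (L^2), with [X0 = 0] and [T = 2], the left-hand side is [-2] times it, that
    is [2 |u|^2 P B], and exceeds [E |X - Y|^2 = |u|^2 P B].  Atomlessness
    provides [B], and dimension one suffices. *)

Set Implicit Arguments.
Unset Strict Implicit.
Unset Printing Implicit Defensive.

Import Order.TTheory GRing.Theory Num.Theory.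
Import numFieldNormedType.Exports.

Local Open Scope classical_set_scope.
Local Open Scope ring_scope.

Section dot.
Context {R : realType} {d : nat}.
Implicit Types (a : R) (x y : 'rV[R]_d).

Lemma dotZl a x y : dot (a *: x) y = a * dot x y.
Proof. by rewrite /dot mulr_sumr; apply: eq_bigr => i _; rewrite mxE mulrA. Qed.

Lemma dotZr a x y : dot x (a *: y) = a * dot x y.
Proof. by rewrite /dot mulr_sumr; apply: eq_bigr => i _; rewrite mxE mulrCA. Qed.

Lemma dot0l x : dot 0 x = 0.
Proof. by rewrite -(scale0r 0) dotZl mul0r. Qed.

Lemma dotNl x y : dot (- x) y = - dot x y.
Proof. by rewrite -scaleN1r dotZl mulN1r. Qed.

Lemma dotNr x y : dot x (- y) = - dot x y.
Proof. by rewrite -scaleN1r dotZr mulN1r. Qed.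

Lemma dotBr x y z : dot x (y - z) = dot x y - dot x z.
Proof. by rewrite /dot -sumrB; apply: eq_bigr => i _; rewrite !mxE mulrBr. Qed.

Lemma sqnorm_gt0 x : x != 0 -> 0 < sqnorm x.
Proof.
move=> x0; rewrite lt_neqAle sqnorm_ge0 andbT eq_sym.
apply: contra x0 => /eqP xx; apply/eqP/rowP => i; rewrite mxE.
have := @psumr_eq0P R 'I_d xpredT (fun i => x 0 i * x 0 i).
move=> /(_ (fun j _ => sqr_ge0 _) xx i isT)/eqP.
by rewrite mulf_eq0 orbb => /eqP.
Qed.

Lemma measurable_dotl x : measurable_fun [set: borelRd R d]
  (fun y : borelRd R d => dot (y : 'rV[R]_d) x).
Proof.
apply: measurable_sum => i.
by apply: measurable_funM => //; exact: measurable_fun_coord.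
Qed.

End dot.

Section indicator_vector.
Context {R : realType} {dsp : measure_display} {Om : measurableType dsp}.
Context {P : probability Om R} (B : set Om) (mB : measurable B).

Lemma integrable_indicZ (k : R) :
  P.-integrable setT (fun w => (k * \1_B w)%:E).
Proof.
have := integrableZl measurableT k (integrable_indic P mB).
by apply: eq_integrable => // w _; rewrite EFinM.
Qed.

Lemma integral_indicZ (k : R) :
  (\int[P]_w (k * \1_B w)%:E = k%:E * P B)%E.
Proof.
rewrite -[in RHS](setIT B) -(integral_indic _ measurableT mB).
by rewrite -integralZl//; exact: integrable_indic.
Qed.

Context {d : nat} (u : 'rV[R]_d).

Definition indic_vec (w : Om) : borelRd R d := \1_B w *: u.

Lemma indic_vecE w : indic_vec w = if w \in B then u else 0.
Proof.
by rewrite /indic_vec indicE; case: (w \in B); rewrite ?scale1r ?scale0r.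
Qed.

Lemma measurable_indic_vec : measurable_fun setT indic_vec.
Proof.
rewrite (funext indic_vecE).
apply: (@measurable_fun_ifT _ _ _ (borelRd R d)) => //.
apply: measurable_fun_bool; rewrite setTI; apply: (eq_ind _ measurable mB).
by apply/seteqP; split => w; [exact: mem_set|exact: set_mem].
Qed.

HB.instance Definition _ :=
  isMeasurableFun.Build _ _ _ _ indic_vec measurable_indic_vec.

Lemma sqnorm_indic_vec w :
  sqnorm (indic_vec w : 'rV[R]_d) = sqnorm u * \1_B w.
Proof.
rewrite /sqnorm dotZl dotZr indicE.
by case: (w \in B); rewrite ?(mulr1, mul1r, mulr0, mul0r).
Qed.

Lemma indic_vec_moment :
  (\int[P]_w (sqnorm (indic_vec w : 'rV[R]_d))%:E < +oo)%E.
Proof.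
under eq_integral do rewrite sqnorm_indic_vec.
rewrite integral_indicZ lte_mul_pinfty ?lee_fin ?sqnorm_ge0//.
by rewrite (le_lt_trans (probability_le1 P mB))// ltry.
Qed.

Definition indic_vec_L2 : L2rv P d :=
  @MkL2rv _ _ _ _ _ indic_vec indic_vec_moment.

End indicator_vector.

Section dirac_indicator.
Context {R : realType} {d : nat} (u : 'rV[R]_d).

(** The simplest non-constant function of a law that ignores translations;
    the variance would be another, but would require computing moments. *)
Definition dirac_indicator (m : P2 R d) : 'rV[R]_d :=
  if `[< exists c : 'rV[R]_d, m [set c] = 1%E >] then u else 0.

(** A translate of a Dirac mass is a Dirac mass, and conversely. *)
Lemma Omega_dirac_indicator m T s :
  Omega dirac_indicator m T s = dirac_indicator m.
Proof.
have shiftE c : (translation (T *: s) : borelRd R d -> borelRd R d)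
    @^-1` [set c] = [set c + T *: s].
  apply/seteqP; split => x /=; rewrite /translation.
    by move=> <-; rewrite subrK.
  by move=> ->; rewrite addrK.
rewrite /Omega /dirac_indicator; congr (if _ then _ else _).
apply: asbool_equiv_eq; split => -[c mc].
  by exists (c + T *: s); rewrite -shiftE.
exists (c - T *: s); rewrite -mc /= /distribution /pushforward.
by congr (m _); rewrite shiftE subrK.
Qed.

Lemma cond_sigma_dirac_indicator : cond_sigma dirac_indicator.
Proof.
move=> m0 T _ s1 s2 _ _.
by rewrite !Omega_dirac_indicator subrr dot0l sqnorm_ge0.
Qed.

Context {dsp : measure_display} {Om : measurableType dsp}.
Context (P : probability Om R).

Lemma dirac_indicator_const (X : L2rv P d) (c : 'rV[R]_d) :
  (forall w, X w = c) -> dirac_indicator (law X) = u.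
Proof.
move=> Xc; rewrite /dirac_indicator ifT//; apply/asboolP; exists c.
rewrite /= /distribution /pushforward -[RHS](@probability_setT _ _ _ P).
by congr (P _); apply/seteqP; split => w //= _; exact: Xc.
Qed.

(** The fibres of [1_B u] are [B], its complement and the empty set, and none
    of them has probability one. *)
Lemma dirac_indicator_indic_vec (B : set Om) (mB : measurable B) :
  u != 0 -> (0 < P B < 1)%E ->
  dirac_indicator (law (indic_vec_L2 (P := P) mB u)) = 0.
Proof.
move=> u0 /andP[PB0 PB1]; rewrite /dirac_indicator ifF//.
apply/asboolP => -[c]; rewrite /= /distribution /pushforward.
have stepE w : (indic_vec B u w = c :> 'rV[R]_d) =
    if w \in B then u = c else 0 = c.
  by rewrite indic_vecE; case: (w \in B).
have [uc|uc] := eqVneq u c.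
  rewrite (_ : _ @^-1` _ = B) => [PB|]; first by rewrite PB ltxx in PB1.
  apply/seteqP; split => w; rewrite /preimage/= stepE.
    case: ifPn => [/set_mem//|_ c0].
    by rewrite -uc in c0; rewrite -c0 eqxx in u0.
  by move=> Bw; rewrite mem_set.
have [c0|c0] := eqVneq 0 c.
  rewrite (_ : _ @^-1` _ = ~` B).
    have PBE := fineK (fin_num_measure P _ mB).
    rewrite probability_setC// -PBE -EFinB => -[PB].
    by move: PB0; rewrite -PBE lte_fin; lra.
  apply/seteqP; split => w; rewrite /preimage/= stepE.
    by case: ifPn => [_ /eqP|/negP + _]; rewrite ?(negbTE uc) ?inE.
  by move=> Bw; rewrite memNset.
rewrite (_ : _ @^-1` _ = set0) ?measure0 => [/esym/eqP|].
  by rewrite onee_eq0.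
apply/seteqP; split => w //; rewrite /preimage/= stepE.
by case: ifP => _ /eqP; rewrite ?(negbTE c0) ?(negbTE uc).
Qed.

End dirac_indicator.

(** Any [sigma] that drops from [u] to [0] as the random vector moves from [0]
    to [1_B u] decreases along the displacement, which refutes the three
    monotonicity conditions. *)
Section decreasing_pair.
Context {R : realType} {d : nat} {dsp : measure_display}.
Context {Om : measurableType dsp} {P : probability Om R}.
Context {sigma : P2 R d -> 'rV[R]_d} {X Y : L2rv P d}.
Context {B : set Om} {u : 'rV[R]_d}.
Context (mB : measurable B) (PB0 : (0 < P B)%E) (u0 : u != 0).
Context (XE : forall w, X w = \1_B w *: u) (YE : forall w, Y w = 0).
Context (sigmaX : sigma (law X) = 0) (sigmaY : sigma (law Y) = u).

Lemma not_condLL : ~ condLL (G_of sigma).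
Proof.
move=> /(_ (law X) (law Y)).
have GE x : G_of sigma x (law X) - G_of sigma x (law Y) = - dot x u.
  by rewrite /G_of -dotBr sigmaX sigmaY sub0r dotNr.
have mG : measurable_fun [set: borelRd R d]
    (fun x => (- dot (x : 'rV[R]_d) u)%:E).
  by apply/measurable_EFinP/measurable_funN; exact: measurable_dotl.
have GXE : (fun x => (- dot (x : 'rV[R]_d) u)%:E) \o L2rv_fun X =
    fun w => (- sqnorm u * \1_B w)%:E.
  apply/funext => w /=; congr EFin.
  by rewrite [L2rv_fun X w]XE dotZl mulNr mulrC.
have GYE : (fun x => (- dot (x : 'rV[R]_d) u)%:E) \o L2rv_fun Y = cst 0%E.
  by apply/funext => w /=; rewrite [L2rv_fun Y w]YE dot0l oppr0.
under eq_integral do rewrite GE.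
under [X in (_ - X)%E]eq_integral do rewrite GE.
rewrite !integral_distribution// ?GXE ?GYE; last 2 first.
- exact: integrable0.
- exact: integrable_indicZ.
rewrite integral0 sube0 integral_indicZ//.
rewrite EFinN mulNe oppe_ge0 leNgt mule_gt0// lte_fin.
exact: sqnorm_gt0.
Qed.

Lemma not_condD : ~ condD P (G_of sigma).
Proof.
move=> /(_ X Y); rewrite unlock.
under eq_integral => w _.
  rewrite !grad_xE sigmaX sigmaY XE YE sub0r subr0 dotZr dotNl.
  rewrite -/(sqnorm u) mulrC.
  over.
rewrite integral_indicZ//.
rewrite EFinN mulNe oppe_ge0 leNgt mule_gt0// lte_fin.
exact: sqnorm_gt0.
Qed.

Lemma not_condL2 : ~ condL2 P (G_of sigma).
Proof.
(* Any horizon larger than 1 makes the left-hand side dominate. *)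
move=> /(_ Y 2 (ltr0n _ _) X Y); rewrite unlock.
under eq_integral => w _.
  rewrite /Etilde !resolventE sigmaX sigmaY XE YE scaler0 !subr0 !sub0r opprK.
  rewrite dotZl dotZr -/(sqnorm u) [_ * sqnorm u]mulrC mulrA.
  over.
under [X in (_ <= X)%E -> _]eq_integral => w _.
  rewrite YE subr0 XE -[_ *: u]/(indic_vec B u w) sqnorm_indic_vec.
  over.
rewrite !integral_indicZ//.
have PBE := fineK (fin_num_measure P _ mB).
have PB : 0 < fine (P B) by rewrite -lte_fin PBE.
rewrite -PBE -!EFinM lee_fin leNgt.
have := mulr_gt0 (sqnorm_gt0 u0) PB; lra.
Qed.

End decreasing_pair.

Theorem proposition4p10 (R : realType) (dsp : measure_display)
    (Om : measurableType dsp) (P : probability Om R) (hP : atomless P) :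
  exists (d : nat) (sigma : P2 R d -> 'rV[R]_d),
    [/\ cond_sigma sigma,
        ~ condLL (G_of sigma),
        ~ condD P (G_of sigma)
      & ~ condL2 P (G_of sigma)].
Proof.
have [||B [mB _ PB0]] := hP setT; first exact: measurableT.
  by rewrite probability_setT.
rewrite probability_setT => PB1.
pose u : 'rV[R]_1 := const_mx 1.
have u0 : u != 0.
  by apply/eqP => /rowP/(_ 0); rewrite !mxE => /eqP; rewrite oner_eq0.
have sX : dirac_indicator u (law (indic_vec_L2 (P := P) mB u)) = 0.
  by apply: dirac_indicator_indic_vec; rewrite ?PB0.
have XE w : indic_vec_L2 (P := P) mB u w = \1_B w *: u by [].
have YE w : indic_vec_L2 (P := P) mB 0 w = 0 :> 'rV[R]_1.
  exact: scaler0.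
have sY := dirac_indicator_const u YE.
exists 1%N, (dirac_indicator u); split.
- exact: cond_sigma_dirac_indicator.
- exact: (not_condLL mB PB0 u0 XE YE sX sY).
- exact: (not_condD mB PB0 u0 XE YE sX sY).
- exact: (not_condL2 mB PB0 u0 XE YE sX sY).
Qed.
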